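(* Let $H$ be a hermitian semiclassical symbol satisfying either condition (IG)$_m$ or condition (CG) (defined in the context), and suppose that $\sigma_{\rm r}(q,p)=\{E_{\rm r}(q,p)\}$ consists of a single eigenvalue of $H_0(q,p)$ of constant multiplicity $\ell$ (including $\ell=\infty$), with spectral projector $\pi_0(q,p)$. Let $\pi=\sum_j\varepsilon^j\pi_j$ be the unique formal symbol with principal part $\pi_0$, $\pi_j\in S^{-j\rho}_\rho$, $\pi\#\pi=\pi$, $\pi^*=\pi$, $H\#\pi=\pi\#H$. Let $\{\psi_\alpha(q,p)\}_{\alpha=1}^\ell$ be an orthonormal basis of $\mathrm{Ran}\,\pi_0(q,p)$ depending smoothly on $(q,p)$, let $\{\chi_\alpha\}_{\alpha=1}^\ell$ be an orthonormal basis of $\mathrm{Ran}\,\pi_{\rm r}$, where $\pi_{\rm r}$ is a fixed orthogonal projection in $\mathcal H_{\rm f}$, and let $$u_0(q,p)=\sum_{\alpha=1}^\ell|\chi_\alpha\rangle\langle\psi_\alpha(q,p)|+r(q,p),$$ where $r(q,p)$ is a unitary from $(\mathrm{Ran}\,\pi_0(q,p))^\perp$ onto $(\mathrm{Ran}\,\pi_{\rm r})^\perp$ (extended by $0$), such that $u_0\in S^0_\rho(\mathcal B(\mathcal H_{\rm f}))$. Let $u=\sum_j\varepsilon^ju_j$, $u_j\in S^{-j\rho}_\rho$, be any formal symbol with principal symbol $u_0$ satisfying $u^*\#u=u\#u^*=1$ and $u\#\pi\#u^*=\pi_{\rm r}$, and let $h=\sum_j\varepsilon^jh_j:=u\#H\#u^*$.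 Then, with $h^{(1)}:=h_0+\varepsilon h_1$, $$\langle\chi_\alpha,h^{(1)}\chi_\beta\rangle=E_{\rm r}\,\delta_{\alpha\beta}+\varepsilon\,h_{1\,\alpha\beta},$$ where $$h_{1\,\alpha\beta}=\langle\chi_\alpha,h_1\chi_\beta\rangle=\langle\psi_\alpha,H_1\psi_\beta\rangle-\frac i2\langle\psi_\alpha,\{(H_0+E_{\rm r}),\psi_\beta\}\rangle$$ $$=\langle\psi_\alpha,H_1\psi_\beta\rangle-i\langle\psi_\alpha,\{E_{\rm r},\psi_\beta\}\rangle-\frac i2\langle\psi_\alpha,\{(H_0-E_{\rm r}),\psi_\beta\}\rangle .$$
   Context: $\mathcal H_{\rm f}$ is a separable complex Hilbert space (inner product linear in the second argument), $z=(q,p)\in\mathbb R^{2d}$, $\langle p\rangle=(1+|p|^2)^{1/2}$. Symbols: for $m\in\mathbb R$, $0\le\rho\le1$, $S^m_\rho=S^m_\rho(\mathcal B(\mathcal H_{\rm f}))$ is the set of $A\in C^\infty(\mathbb R^{2d},\mathcal B(\mathcal H_{\rm f}))$ with $\sup_q\|\partial_q^\alpha\partial_p^\beta A(q,p)\|\le C_{\alpha,\beta}\langle p\rangle^{m-\rho|\beta|}$ for all $\alpha,\beta\in\mathbb N^d$, with Fréchet semi-norms $\|A\|^{(m)}_k=\sup_{|\alpha|+|\beta|\le k}\sup_{q,p}\langle p\rangle^{-m+\rho|\beta|}\|\partial_q^\alpha\partial_p^\beta A(q,p)\|$. A semiclassical symbol of order $m$ and weight $\rho$ is a map $[0,\varepsilon_0)\ni\varepsilon\mapsto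 A_\varepsilon\in S^m_\rho$ for which there are $A_j\in S^{m-j\rho}_\rho$ with $\|A_\varepsilon-\sum_{j=0}^{n-1}\varepsilon^jA_j\|_k^{(m-n\rho)}\le C_{n,k}\varepsilon^n$ for all $n,k\in\mathbb N$; one writes $A\in S^m_\rho(\varepsilon)$; $A_0$ is the principal and $A_1$ the subprincipal symbol, and $A$ is identified with its formal expansion $\sum_j\varepsilon^jA_j$. A symbol is hermitian if its values are self-adjoint. Formal symbols are formal power series $\sum_j\varepsilon^jA_j$ with coefficients in $\bigcup_mS^m_\rho$, with involution $A^*=\sum_j\varepsilon^jA_j^*$ and the (associative) Moyal product $(A\,\#\,B)_k=\sum_{|\alpha|+|\beta|+j+l=k}\frac{(-1)^{|\alpha|}}{(2i)^{|\alpha|+|\beta|}\alpha!\beta!}(\partial_q^\alpha\partial_p^\beta A_j)(\partial_p^\alpha\partial_q^\beta B_l)$. Poisson bracket: $\{A,B\}=\sum_{j=1}^d\big(\partial_{p_j}A\,\partial_{q_j}B-\partial_{q_j}A\,\partial_{p_j}B\big)$, where $A$ is operator-valued (or scalar, regarded as a multiple of the identity) and $B$ may be $\mathcal H_{\rm f}$-valued, derivatives of $A$ acting on derivatives of $B$. Condition (Gap)$_\sigma$: for every $z$ the spectrum $\sigma(z)$ of $H_0(z)\in\mathcal B(\mathcal H_{\rm f})$ contains a subset $\sigma_{\rm r}(z)$ and there are continuous functions $\gamma_-\le\gamma_+$ from $\mathbb R^{2d}$ to $\mathbb R$ such that, with $I(z)=[\gamma_-(z),\gamma_+(z)]$: (G1)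 $\sigma_{\rm r}(z)\subseteq I(z)$; (G2) $\mathrm{dist}(\sigma(z)\setminus\sigma_{\rm r}(z),I(z))\ge C_g\langle p\rangle^\sigma$ for a constant $C_g>0$ independent of $z$; (G3) $\sup_z|\gamma_+(z)-\gamma_-(z)|<\infty$. Condition (IG)$_m$: $H\in S^m_\rho(\varepsilon)$ is hermitian, with $\rho>0$, $m\ge0$, and $H_0$ satisfies (Gap)$_\sigma$ with $\sigma=m$. Condition (CG): $H\in S^0_0(\varepsilon)$ is hermitian (so $\rho=0$) and $H_0$ satisfies (Gap)$_\sigma$ with $\sigma=0$. *)

(* Defs.v *)
From HB Require Import structures.
From mathcomp Require Import all_boot all_order all_algebra complex.
From mathcomp Require Import all_classical all_reals all_analysis.

Set Implicit Arguments.
Unset Strict Implicit.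
Unset Printing Implicit Defensive.

Import Order.TTheory GRing.Theory Num.Theory.
Import numFieldNormedType.Exports.

Local Open Scope classical_set_scope.
Local Open Scope ring_scope.
Local Open Scope complex_scope.

(* Complex Hilbert spaces; the inner product is linear in the second argument. *)
HB.mixin Record CompleteNormedModule_isHilbert (R : realType) V
    & CompleteNormedModule R[i] V := {
  dotH : V -> V -> R[i];
  dotHDr : forall x y z : V, dotH x (y + z) = dotH x y + dotH x z;
  dotHZr : forall (a : R[i]) (x y : V), dotH x (a *: y) = a * dotH x y;
  dotHC : forall x y : V, dotH y x = (dotH x y)^*;
  dotH_norm : forall x : V, dotH x x = `|x| ^+ 2 }.

#[short(type="hilbertType")]
HB.structure Definition Hilbert (R : realType) :=
  {V of CompleteNormedModule R[i] V & CompleteNormedModule_isHilbert R V}.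

Notation "⟨ x , y ⟩" := (dotH x y)
  (at level 0, x, y at level 99, format "⟨ x ,  y ⟩") : ring_scope.

Definition separable_space (T : topologicalType) :=
  exists D : set T, countable D /\ dense D.

Section RealNorm.
Context {R : realType}.

(* The norm of a normed module over R[i] takes its values in R[i]; rnorm is the
   same number seen in R, and modC the modulus of a complex number. *)
Definition rnorm {V : normedModType R[i]} (x : V) : R := complex.Re `|x|.
Definition modC (x : R[i]) : R := complex.Re `|x|.

Lemma nnegC_real (x : R[i]) : 0 <= x -> x = (complex.Re x)%:C.
Proof. by case: x => a b; rewrite lecE => /andP[/= /eqP -> _]. Qed.

Lemma rnormE (V : normedModType R[i]) (x : V) : `|x| = (rnorm x)%:C.
Proof. exact/nnegC_real/normr_ge0. Qed.

Lemma modCE (x : R[i]) : `|x| = (modC x)%:C.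
Proof. exact/nnegC_real/normr_ge0. Qed.

Lemma rnorm_ge0 (V : normedModType R[i]) (x : V) : 0 <= rnorm x.
Proof. by rewrite -lecR -rnormE; exact: normr_ge0. Qed.

Lemma modC_ge0 (x : R[i]) : 0 <= modC x.
Proof. by rewrite -lecR -modCE; exact: normr_ge0. Qed.

Lemma rnorm0 (V : normedModType R[i]) : rnorm (0 : V) = 0.
Proof. by rewrite /rnorm normr0. Qed.

Lemma rnormD (V : normedModType R[i]) (x y : V) :
  rnorm (x + y) <= rnorm x + rnorm y.
Proof. by rewrite -lecR rmorphD/= -!rnormE; exact: ler_normD. Qed.

Lemma rnormZ (V : normedModType R[i]) (a : R[i]) (x : V) :
  rnorm (a *: x) = modC a * rnorm x.
Proof. by rewrite {1}/rnorm normrZ modCE rnormE -rmorphM. Qed.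

Lemma rnorm_eq0 (V : normedModType R[i]) (x : V) : rnorm x = 0 -> x = 0.
Proof. by move=> x0; apply/eqP; rewrite -normr_eq0 rnormE x0. Qed.

End RealNorm.

Section BoundedOperators.
Context {R : realType} {V : normedModType R[i]}.

Definition bounded_op (f : V -> V) :=
  linear f /\ exists M : R, forall x, rnorm (f x) <= M * rnorm x.

Definition bop_pred : {pred (V -> V)} := fun f => `[< bounded_op f >].

Lemma bop_pred_submod : submod_closed bop_pred.
Proof.
split.
  apply/asboolP; split; first by move=> a x y; rewrite scaler0 addr0.
  by exists 0 => x; rewrite rnorm0 mul0r.
move=> a f g /asboolP[fl [M fM]] /asboolP[gl [N gN]].
apply/asboolP; split.
  move=> b x y.
  rewrite -[LHS]/(a *: f (b *: x + y) + g (b *: x + y)).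
  rewrite -[RHS]/(b *: (a *: f x + g x) + (a *: f y + g y)).
  by rewrite fl gl !scalerDr !scalerA (mulrC a b) addrACA.
exists (modC a * M + N) => x.
apply: le_trans (rnormD _ _) _.
by rewrite mulrDl lerD// rnormZ -mulrA ler_wpM2l ?modC_ge0.
Qed.

HB.instance Definition _ :=
  GRing.isSubmodClosed.Build R[i] (V -> V) bop_pred bop_pred_submod.

(* The space B(V) of bounded linear operators. *)
Record bop := Bop { bop_fun :> V -> V; _ : bop_fun \in bop_pred }.

HB.instance Definition _ := [isSub for bop_fun].
HB.instance Definition _ := [Choice of bop by <:].
HB.instance Definition _ := [SubChoice_isSubLmodule of bop by <:].

Lemma bopP (T : bop) : bounded_op T.
Proof. by case: T => f fP; exact/asboolP. Qed.

Definition mkbop (f : V -> V) (fP : bounded_op f) : bop :=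
  Bop (introT (asboolP _) fP).

(* Below, bop V is made a normed module with norm (opnorm T)%:C. *)
Definition opnorm (T : bop) : R := sup [set rnorm (T x) | x in [set x | rnorm x <= 1]].

Lemma opnorm_has_sup (T : bop) :
  has_sup [set rnorm (T x) | x in [set x | rnorm x <= 1]].
Proof.
have [_ [M TM]] := bopP T; split; first by exists (rnorm (T 0)), 0 => //=; rewrite rnorm0.
exists `|M| => _ [x /= x1 <-]; apply: le_trans (TM x) _.
rewrite -[leRHS]mulr1; apply: le_trans (ler_wpM2r (rnorm_ge0 x) (ler_norm M)) _.
by rewrite ler_wpM2l.
Qed.

Lemma opnorm_ge0 (T : bop) : 0 <= opnorm T.
Proof.
apply: le_trans (rnorm_ge0 (T 0)) _; apply: ub_le_sup.
  by have [] := opnorm_has_sup T.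
by exists 0 => //=; rewrite rnorm0.
Qed.

Lemma opnormP (T : bop) (x : V) : rnorm (T x) <= opnorm T * rnorm x.
Proof.
have [Tl _] := bopP T.
have TZ a y : T (a *: y) = a *: T y.
  have T0 : T 0 = 0 by have := Tl (-1) 0 0; rewrite scaler0 addr0 scaleN1r addNr.
  by have := Tl a y 0; rewrite !addr0 T0 addr0.
have [x0|x0] := eqVneq (rnorm x) 0.
  by rewrite x0 mulr0 (rnorm_eq0 x0) -(scale0r (0 : V)) TZ scale0r rnorm0.
have xgt0 : 0 < rnorm x by rewrite lt_def x0 rnorm_ge0.
rewrite -ler_pdivrMr//; apply: ub_le_sup.
  by have [] := opnorm_has_sup T.
have modV : modC ((rnorm x)^-1)%:C = (rnorm x)^-1.
  by rewrite /modC ger0_norm// lecR invr_ge0 rnorm_ge0.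
exists (((rnorm x)^-1)%:C *: x); rewrite /= ?TZ rnormZ modV.
  by rewrite mulVf.
by rewrite mulrC.
Qed.

Lemma opnorm_le (T : bop) (M : R) :
  (forall x, rnorm x <= 1 -> rnorm (T x) <= M) -> opnorm T <= M.
Proof.
move=> TM; apply: ge_sup; first by have [] := opnorm_has_sup T.
by move=> _ [x x1 <-]; apply: TM.
Qed.

Let opnormC (T : bop) : R[i] := (opnorm T)%:C.

Let opnormC_D (S T : bop) : opnormC (S + T) <= opnormC S + opnormC T.
Proof.
rewrite -rmorphD lecR; apply: opnorm_le => x x1.
apply: le_trans (rnormD _ _) _.
by apply: lerD; (apply: le_trans (opnormP _ _) _; rewrite ler_piMr ?opnorm_ge0).
Qed.

Let opnormC_Z (a : R[i]) (T : bop) : opnormC (a *: T) = `|a| * opnormC T.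
Proof.
rewrite modCE -rmorphM; congr (_%:C); apply/eqP; rewrite eq_le; apply/andP; split.
  apply: opnorm_le => x x1; rewrite [X in rnorm X]/(a *: T x) rnormZ.
  rewrite ler_wpM2l ?modC_ge0//.
  by apply: le_trans (opnormP _ _) _; rewrite ler_piMr ?opnorm_ge0.
have [a0|a0] := eqVneq (modC a) 0; first by rewrite a0 mul0r opnorm_ge0.
have agt0 : 0 < modC a by rewrite lt_def a0 modC_ge0.
rewrite mulrC -ler_pdivlMr//; apply: opnorm_le => x x1.
rewrite ler_pdivlMr// mulrC -rnormZ.
apply: le_trans (opnormP (a *: T) x) _.
by rewrite ler_piMr ?opnorm_ge0.
Qed.

Let opnormC_eq0 (T : bop) : opnormC T = 0 -> T = 0.
Proof.
move=> /(congr1 (@complex.Re R))/= T0; apply/val_inj/funext => x /=.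
apply/rnorm_eq0/eqP; rewrite eq_le rnorm_ge0 andbT.
by have := opnormP T x; rewrite T0 mul0r.
Qed.

HB.instance Definition _ :=
  @Lmodule_isNormed.Build R[i] bop opnormC opnormC_D opnormC_Z opnormC_eq0.

Lemma rnorm_bopE (T : bop) : rnorm T = opnorm T.
Proof. by []. Qed.

Lemma bop_id_subproof : bounded_op (@id V).
Proof. by split => //; exists 1 => x; rewrite mul1r. Qed.

Definition bop_id : bop := mkbop bop_id_subproof.

Lemma bop_comp_subproof (S T : bop) : bounded_op (S \o T).
Proof.
have [[Sl _] [Tl _]] := (bopP S, bopP T).
split; first by move=> a x y /=; rewrite Tl Sl.
exists (opnorm S * opnorm T) => x /=.
apply: le_trans (opnormP _ _) _.
by rewrite -mulrA ler_wpM2l ?opnorm_ge0 ?opnormP.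
Qed.

Definition bop_comp (S T : bop) : bop := mkbop (bop_comp_subproof S T).

End BoundedOperators.
Arguments bop {R} V.

Section HilbertOperators.
Context {R : realType} {V : hilbertType R}.
Implicit Types (T S P : bop V) (M : set V).

(* The adjoint exists and is unique by Riesz representation; xget picks it. *)
Definition adj T : bop V := xget (0 : bop V) [set S : bop V | forall x y, ⟨S x, y⟩ = ⟨x, T y⟩].

Definition selfadjoint T := forall x y, ⟨T x, y⟩ = ⟨x, T y⟩.

Definition orthogonal_projection P := bop_comp P P = P /\ selfadjoint P.

Definition spectrum T : set R[i] :=
  [set a | ~ exists S : bop V,
    bop_comp S (T - a *: bop_id) = bop_id /\
    bop_comp (T - a *: bop_id) S = bop_id].

Definition eigenspace_of T (a : R[i]) : set V := [set x | T x = a *: x].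

(* The spectral projector of a self-adjoint T for a single eigenvalue a. *)
Definition spectral_projector T (a : R[i]) P :=
  orthogonal_projection P /\ range P = eigenspace_of T a.

Definition orthocomp M : set V := [set x | forall y, M y -> ⟨y, x⟩ = 0].

Definition finite_basis n M (b : 'I_n -> V) :=
  [/\ forall i, M (b i),
      forall c : 'I_n -> R[i], \sum_(i < n) c i *: b i = 0 -> forall i, c i = 0
    & forall x, M x -> exists c : 'I_n -> R[i], x = \sum_(i < n) c i *: b i].

(* Dimensions are finite (Some n) or infinite (None). *)
Definition has_dim M (l : option nat) :=
  if l is Some n then exists b : 'I_n -> V, finite_basis M b
  else forall n (b : 'I_n -> V), ~ finite_basis M b.

Definition is_eigenvalue_of_mult T (a : R[i]) (l : option nat) :=
  (exists2 x, x != 0 & eigenspace_of T a x) /\ has_dim (eigenspace_of T a) l.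

(* Families of length l are functions on nat restricted to indices below l,
   counted from 0. *)
Definition below (l : option nat) (a : nat) : bool :=
  if l is Some n then (a < n)%N else true.

Definition orthonormal_basis (l : option nat) M (e : nat -> V) :=
  [/\ forall a, below l a -> M (e a),
      forall a b, below l a -> below l b -> ⟨e a, e b⟩ = (a == b)%:R
    & forall x, M x ->
        (fun n => \sum_(a < n | below l a) ⟨e a, x⟩ *: e a) @ \oo --> x].

(* r is unitary from M onto N, extended by 0 to the orthogonal complement. *)
Definition unitary_onto_ext0 M N (r : bop V) :=
  [/\ forall x y, M x -> M y -> ⟨r x, r y⟩ = ⟨x, y⟩,
      r @` M = N
    & forall x, orthocomp M x -> r x = 0].

End HilbertOperators.

Section PhaseSpace.
Context {R : realType} {d : nat}.

Definition phase := ('rV[R]_d * 'rV[R]_d)%type.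

(* <p>, with the Euclidean norm of p. *)
Definition jap (p : 'rV[R]_d) : R := Num.sqrt (1 + \sum_(j < d) p 0 j ^+ 2).

(* inl j is the direction q_j, inr j is the direction p_j. *)
Definition direction (i : 'I_d + 'I_d) : phase :=
  match i with
  | inl j => (delta_mx 0 j, 0)
  | inr j => (0, delta_mx 0 j)
  end.

Section Derivatives.
Context {W : normedModType R[i]}.
Implicit Types (f : phase -> W) (z : phase).

(* The library's derive needs source and target over the same field; here the
   source is real and the target complex. *)
Definition diffquot f (i : 'I_d + 'I_d) z (t : R) : W :=
  (t^-1)%:C *: (f (z + t *: direction i) - f z).

Definition partial (i : 'I_d + 'I_d) f : phase -> W :=
  fun z => lim (diffquot f i z @ 0^').

Definition smooth f :=
  forall s : seq ('I_d + 'I_d), let g := foldr partial f s in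
    continuous g /\ forall i z, cvg (diffquot g i z @ 0^').

Definition morder (a : 'I_d -> nat) : nat := \sum_(j < d) a j.

Definition partials (dir : 'I_d -> 'I_d + 'I_d) (a : 'I_d -> nat) f :=
  foldr (fun j g => iter (a j) (partial (dir j)) g) f (enum 'I_d).

(* Dqp a b f is the derivative of f of multi-order a in q and b in p. *)
Definition Dqp (a b : 'I_d -> nat) f : phase -> W :=
  partials inl a (partials inr b f).

End Derivatives.
End PhaseSpace.
Arguments phase R d : clear implicits.

Section Symbols.
Context {R : realType} {d : nat} {V : hilbertType R}.
Local Notation opfun := (phase R d -> bop V).
Implicit Types (m rho : R).

(* A belongs to S^m_rho. *)
Definition symbol m rho (A : opfun) :=
  smooth A /\
  forall a b : 'I_d -> nat, exists C : R, forall z,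
    opnorm (Dqp a b A z) <= C * jap z.2 `^ (m - rho * (morder b)%:R).

(* The semi-norm of index k of S^m_rho. *)
Definition seminorm m rho (k : nat) (A : opfun) : \bar R :=
  ereal_sup [set x | exists a b : 'I_d -> nat, exists z,
    (morder a + morder b <= k)%N /\
    x = (jap z.2 `^ (- m + rho * (morder b)%:R) * opnorm (Dqp a b A z))%:E].

Definition semiclassical m rho (eps0 : R) (A : R -> opfun) (Aj : nat -> opfun) :=
  [/\ 0 < eps0,
      forall eps, 0 <= eps < eps0 -> symbol m rho (A eps),
      forall j, symbol (m - j%:R * rho) rho (Aj j)
    & forall n k : nat, exists C : R, forall eps, 0 <= eps < eps0 ->
        (seminorm (m - n%:R * rho) rho k
           (fun z => (A eps z - \sum_(j < n) (eps ^+ j)%:C *: Aj j z)%R)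
         <= (C * eps ^+ n)%:E)%E].

Definition hermitian_on (eps0 : R) (A : R -> opfun) :=
  forall eps z, 0 <= eps < eps0 -> selfadjoint (A eps z).

Definition set_dist (X Y : set R[i]) : \bar R :=
  ereal_inf [set (modC (x - y))%:E | x in X & y in Y].

(* The condition (Gap)_sigma for H0 and the part sr of its spectrum. *)
Definition gap (sigma : R) (H0 : opfun) (sr : phase R d -> set R[i]) :=
  (forall z, sr z `<=` spectrum (H0 z)) /\
  exists gm gp : phase R d -> R,
    let I z := [set x%:C | x in `[gm z, gp z]] in
    [/\ continuous gm /\ continuous gp,
        forall z, gm z <= gp z,
        forall z, sr z `<=` I z,
        exists2 Cg : R, 0 < Cg & forall z,
          ((Cg * jap z.2 `^ sigma)%:E
             <= set_dist (spectrum (H0 z) `\` sr z) (I z))%E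
      & exists M : R, forall z, `|gp z - gm z| <= M].

(* In both conditions the principal symbol H_0 is Hj 0. *)
Definition condIG m rho eps0 (H : R -> opfun) (Hj : nat -> opfun) sr :=
  [/\ semiclassical m rho eps0 H Hj, hermitian_on eps0 H,
      0 < rho, 0 <= m & gap m (Hj 0%N) sr].

Definition condCG m rho eps0 (H : R -> opfun) (Hj : nat -> opfun) sr :=
  [/\ semiclassical m rho eps0 H Hj, hermitian_on eps0 H,
      rho = 0, m = 0 & gap 0 (Hj 0%N) sr].

(* Formal power series in epsilon, given by their coefficients. *)
Definition formal := nat -> opfun.

Definition fadj (A : formal) : formal := fun k z => adj (A k z).

Definition fconst (T : bop V) : formal := fun k _ => if k == 0%N then T else 0.

Definition mfact (a : 'I_d -> nat) : nat := \prod_(j < d) (a j)`!.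

Definition moyal_term (a b : 'I_d -> nat) (A B : opfun) : opfun := fun z =>
  ((-1) ^+ morder a
    / ((2 * 'i) ^+ (morder a + morder b) * (mfact a)%:R * (mfact b)%:R))
  *: bop_comp (Dqp a b A z) (Dqp b a B z).

(* Since |a| + |b| + j + l = k, all the indices involved are at most k. *)
Definition mindex k (a : {ffun 'I_d -> 'I_k.+1}) : 'I_d -> nat := fun i => a i.

Definition moyal (A B : formal) : formal := fun k z =>
  \sum_(a : {ffun 'I_d -> 'I_k.+1}) \sum_(b : {ffun 'I_d -> 'I_k.+1})
  \sum_(j < k.+1)
  \sum_(l < k.+1 | (morder (mindex a) + morder (mindex b) + j + l == k)%N)
    moyal_term (mindex a) (mindex b) (A j) (B l) z.

(* {A, psi} for operator-valued A and V-valued psi. *)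
Definition poisson (A : opfun) (psi : phase R d -> V) : phase R d -> V := fun z =>
  \sum_(j < d) (partial (inr j) A z (partial (inl j) psi z)
              - partial (inl j) A z (partial (inr j) psi z)).

(* A real function seen as a multiple of the identity. *)
Definition scalar_op (E : phase R d -> R) : opfun := fun z => (E z)%:C *: bop_id.

End Symbols.

(* Main.v *)
Require Import Defs.
From mathcomp Require Import all_boot all_order all_algebra complex.
From mathcomp Require Import all_classical all_reals all_analysis ring.

Set Implicit Arguments.
Unset Strict Implicit.
Unset Printing Implicit Defensive.

Import Order.TTheory GRing.Theory Num.Theory.
Import numFieldNormedType.Exports.

Local Open Scope classical_set_scope.
Local Open Scope ring_scope.
Local Open Scope complex_scope.

(** At order zero the hypotheses on [u] say that [u_0] is unitary with
    [u_0 psi_b = chi_b], so [u_0^* chi_b = psi_b], and [H#pi = pi#H] makes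
    [Ran pi_0] invariant for [H_0] from the left as well:
    [<psi_a, H_0 y> = E_r <psi_a, y>].  In
      [h_1 = u_0 H_0 u_1^* + (u#H)_1 u_0^* + (1/2i) {u_0 H_0, u_0^*}]
    the coefficient [u_1^*] is eliminated by order one of [u#u^* = 1]; between [chi_a] and
    [chi_b] both terms in [u_1] carry the factor [E_r] and cancel.  The derivatives
    of [u_0] that remain are removed by differentiating [H_0 psi_b = E_r psi_b] and
    [u_0 psi_b = chi_b].  Neither the associativity of the Moyal product nor the
    existence of adjoints is needed: [adj u_0] is the adjoint because it inverts
    [u_0] (the junk value [0] does not), and it is differentiable as an inverse. *)

(** * Pointwise calculus of bounded operators *)

Section BoundedOperatorAlgebra.
Context {R : realType} {V : normedModType R[i]}.
Implicit Types (S T : bop V) (x y : V).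

Lemma bopDl S T x : (S + T) x = S x + T x. Proof. by []. Qed.
Lemma bopNl T x : (- T) x = - T x. Proof. by []. Qed.
Lemma bopBl S T x : (S - T) x = S x - T x. Proof. by []. Qed.
Lemma bopZl c T x : (c *: T) x = c *: T x. Proof. by []. Qed.
Lemma bop0l x : (0 : bop V) x = 0. Proof. by []. Qed.

Lemma bop_suml (I : Type) (s : seq I) (P : pred I) (F : I -> bop V) x :
  (\sum_(i <- s | P i) F i) x = \sum_(i <- s | P i) F i x.
Proof. exact: (big_morph (fun T : bop V => T x) (fun S T => bopDl S T x) (bop0l x)). Qed.

Lemma bop0r T : T 0 = 0.
Proof. by have [Tl _] := bopP T; have := Tl (-1) 0 0; rewrite scaler0 addr0 scaleN1r addNr. Qed.

Lemma bopZr T c x : T (c *: x) = c *: T x.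
Proof. by have [Tl _] := bopP T; have := Tl c x 0; rewrite !addr0 bop0r addr0. Qed.

Lemma bopDr T x y : T (x + y) = T x + T y.
Proof. by have [Tl _] := bopP T; have := Tl 1 x y; rewrite !scale1r. Qed.

Lemma bopNr T x : T (- x) = - T x.
Proof. by rewrite -scaleN1r bopZr scaleN1r. Qed.

Lemma bopBr T x y : T (x - y) = T x - T y.
Proof. by rewrite bopDr bopNr. Qed.

Lemma bop_compE S T x : bop_comp S T x = S (T x). Proof. by []. Qed.

Lemma bop_ext S T : (forall x, S x = T x) -> S = T.
Proof. by move=> ST; apply/val_inj/funext. Qed.

Lemma opnorm_comp_le S T : opnorm (bop_comp S T) <= opnorm S * opnorm T.
Proof.
apply: opnorm_le => x x1; rewrite bop_compE.
apply: le_trans (opnormP _ _) _; rewrite ler_wpM2l ?opnorm_ge0//.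
by apply: le_trans (opnormP _ _) _; rewrite ler_piMr ?opnorm_ge0.
Qed.

Lemma opnorm_id_le1 : opnorm (bop_id : bop V) <= 1.
Proof. by apply: opnorm_le => x. Qed.

End BoundedOperatorAlgebra.

(** * Sesquilinearity of the inner product and the Cauchy-Schwarz inequality *)

Section InnerProduct.
Context {R : realType} {V : hilbertType R}.
Implicit Types (x y : V).

Lemma dotH0r x : ⟨x, (0 : V)⟩ = 0.
Proof. by rewrite -(scale0r (0 : V)) dotHZr mul0r. Qed.

Lemma dotHNr x y : ⟨x, - y⟩ = - ⟨x, y⟩.
Proof. by rewrite -scaleN1r dotHZr mulN1r. Qed.

Lemma dotHBr x y z : ⟨x, y - z⟩ = ⟨x, y⟩ - ⟨x, z⟩.
Proof. by rewrite dotHDr dotHNr. Qed.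

Lemma dotH_sumr (I : Type) (s : seq I) (P : pred I) (F : I -> V) x :
  ⟨x, \sum_(i <- s | P i) F i⟩ = \sum_(i <- s | P i) ⟨x, F i⟩.
Proof. exact: (big_morph (dotH x) (dotHDr x) (dotH0r x)). Qed.

Lemma dotHDl x y z : ⟨x + y, z⟩ = ⟨x, z⟩ + ⟨y, z⟩.
Proof. by rewrite dotHC dotHDr rmorphD/= -!dotHC. Qed.

Lemma dotHZl c x y : ⟨c *: x, y⟩ = c^* * ⟨x, y⟩.
Proof. by rewrite dotHC dotHZr rmorphM/= -dotHC. Qed.

Lemma dotHxx x : ⟨x, x⟩ = (rnorm x ^+ 2)%:C.
Proof. by rewrite dotH_norm rnormE rmorphXn. Qed.

Lemma modC_sqr (c : R[i]) : c^* * c = (modC c ^+ 2)%:C.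
Proof. by rewrite rmorphXn/= -modCE normCKC. Qed.

(** With [n = |x|^2] and [c = ⟨x, y⟩], the vector [n y - c x] is orthogonal to [x], so its squared
    norm is [n (n |y|^2 - |c|^2)]. Nonnegativity gives the bound after cancelling [n > 0]; the case
    [x = 0] is treated apart. *)
Lemma cauchy_schwarz x y : modC ⟨x, y⟩ <= rnorm x * rnorm y.
Proof.
have [x0|x0] := eqVneq (rnorm x) 0.
  by rewrite (rnorm_eq0 x0) dotHC dotH0r conjc0 rnorm0 mul0r /modC normr0.
have xgt0 : 0 < rnorm x by rewrite lt_def x0 rnorm_ge0.
set c := ⟨x, y⟩; set n := rnorm x ^+ 2.
have ngt0 : 0 < n by rewrite exprn_gt0.
have : ⟨n%:C *: y - c *: x, n%:C *: y - c *: x⟩ = (n * (n * rnorm y ^+ 2 - modC c ^+ 2))%:C.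
  set v := _ - _.
  have xv : ⟨x, v⟩ = 0 by rewrite dotHBr !dotHZr dotHxx mulrC subrr.
  have yv : ⟨y, v⟩ = (n * rnorm y ^+ 2 - modC c ^+ 2)%:C.
    rewrite dotHBr !dotHZr dotHxx (dotHC x y) -/c [c * _]mulrC modC_sqr.
    by rewrite -rmorphM -rmorphB.
  rewrite {2}/v dotHBr !dotHZr (dotHC x v) (dotHC y v) xv yv conjc0 mulr0 subr0.
  by rewrite conjc_real -rmorphM.
rewrite dotHxx => /(congr1 (@complex.Re R))/= nE.
have : 0 <= n * (n * rnorm y ^+ 2 - modC c ^+ 2) by rewrite -nE sqr_ge0.
rewrite pmulr_rge0// subr_ge0 /n -exprMn ler_pXn2r//.
- exact: modC_ge0.
- by rewrite nnegrE mulr_ge0 ?rnorm_ge0.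
Qed.

End InnerProduct.

(** * Partial derivatives with a prescribed value, and the product rule *)

Section PartialDerivatives.
Context {R : realType} {d : nat}.
Implicit Types (W : normedModType R[i]) (i : 'I_d + 'I_d) (z : phase R d).

Lemma cvgR0P (T : Type) (F : set_system T) {FF : Filter F} (f : T -> R) :
  f @ F --> (0 : R) <-> forall e : R, 0 < e -> \forall t \near F, `|f t| < e.
Proof. by rewrite cvgr0Pnorm_lt. Qed.

(** Moves convergence from a norm with values in [R[i]] to the real line, where squeezing is
    available. A positive element of [R[i]] is real, so both sides quantify over the same radii. *)
Lemma cvg_rnorm W (T : Type) (F : set_system T) {FF : Filter F} (f : T -> W) (a : W) :
  f @ F --> a <-> (fun t => rnorm (f t - a)) @ F --> (0 : R).
Proof.
split.
  move=> /cvgrPdist_lt fa; apply/cvgR0P => e e0.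
  have := fa e%:C; rewrite ltcR => /(_ e0); apply: filterS => t.
  by rewrite rnormE ltcR ger0_norm ?rnorm_ge0// /rnorm distrC.
move=> /cvgR0P fa; apply/cvgrPdist_lt => e e0.
have eE := nnegC_real (ltW e0).
have := fa (complex.Re e); rewrite -ltcR -eE => /(_ e0); apply: filterS => t.
by rewrite eE distrC rnormE ltcR ger0_norm ?rnorm_ge0.
Qed.

(** A relation carries the existence of the limit together with its value, whereas [partial] is a
    [lim] and is arbitrary when the quotient diverges. *)
Definition has_partial W (f : phase R d -> W) i z (a : W) :=
  diffquot f i z @ 0^' --> a.

Lemma partialE W (f : phase R d -> W) i z a : has_partial f i z a -> partial i f z = a.
Proof. by move=> fa; apply: cvg_lim => //; exact: norm_hausdorff. Qed.

Lemma smooth_partial W (f : phase R d -> W) i z :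
  smooth f -> has_partial f i z (partial i f z).
Proof. by move=> /(_ [::]) [_ /(_ i z)]. Qed.

Lemma has_partial_cst W (a : W) i z : has_partial (fun=> a) i z 0.
Proof.
apply: cvg_near_cst; apply: nearW => t.
by rewrite /diffquot subrr scaler0.
Qed.

Lemma has_partialD W (f g : phase R d -> W) i z a b :
  has_partial f i z a -> has_partial g i z b ->
  has_partial (fun w => f w + g w) i z (a + b).
Proof.
move=> fa gb; rewrite /has_partial.
rewrite (_ : diffquot _ i z = fun t => diffquot f i z t + diffquot g i z t).
  exact: cvgD.
by apply/funext => t; rewrite /diffquot opprD addrACA scalerDr.
Qed.

Lemma has_partialN W (f : phase R d -> W) i z a :
  has_partial f i z a -> has_partial (fun w => - f w) i z (- a).
Proof.
move=> fa; rewrite /has_partial.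
rewrite (_ : diffquot _ i z = fun t => - diffquot f i z t).
  exact: cvgN.
by apply/funext => t; rewrite /diffquot -opprD scalerN.
Qed.

Lemma modC_real (t : R) : modC t%:C = `|t|.
Proof. by rewrite /modC normc_def/= expr0n/= addr0 sqrtr_sqr. Qed.

Lemma diffquotK W (f : phase R d -> W) i z (t : R) : t != 0 ->
  f (z + t *: direction i) = f z + t%:C *: diffquot f i z t.
Proof.
by move=> t0; rewrite /diffquot scalerA -rmorphM/= mulfV// scale1r [RHS]addrC subrK.
Qed.

(** Continuity along one coordinate line: the increment is [t] times the difference quotient, whose
    norm is at most [rnorm (diffquot f i z t - a) + rnorm a]. *)
Lemma has_partial_line W (f : phase R d -> W) i z a : has_partial f i z a ->
  (fun t : R => rnorm (f (z + t *: direction i) - f z)) @ 0^' --> (0 : R).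
Proof.
move=> /cvg_rnorm fa.
have tcvg : (fun t : R => `|t|) @ 0^' --> (0 : R).
  apply/cvgR0P => e e0; near=> t; rewrite normr_id.
  by near: t; exact: dnbhs0_lt.
have bnd : (fun t : R => `|t| * (rnorm (diffquot f i z t - a) + rnorm a)) @ 0^' --> (0 : R).
  rewrite -[X in _ --> X](mul0r (0 + rnorm a)); apply: cvgM => //.
  by apply: cvgD => //; exact: cvg_cst.
apply: squeeze_cvgr (cvg_cst (0 : R)) bnd.
near=> t; rewrite rnorm_ge0/= diffquotK; last by near: t; exact: nbhs_dnbhs_neq.
rewrite [f z + _]addrC addrK rnormZ modC_real ler_wpM2l//.
by rewrite -{1}(subrK a (diffquot f i z t)) rnormD.
Unshelve. all: by end_near. Qed.

(** One product rule serves composition, application and the inner product. Homogeneity is asked for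
    real scalars only, so that a form conjugate-linear in its first argument qualifies. *)
Lemma has_partial_bilinear (W1 W2 W3 : normedModType R[i]) (B : W1 -> W2 -> W3)
  (f : phase R d -> W1) (g : phase R d -> W2) i z a b :
  (forall x x' y, B (x + x') y = B x y + B x' y) ->
  (forall x y y', B x (y + y') = B x y + B x y') ->
  (forall (c : R) x y, B (c%:C *: x) y = c%:C *: B x y) ->
  (forall (c : R) x y, B x (c%:C *: y) = c%:C *: B x y) ->
  (forall x y, rnorm (B x y) <= rnorm x * rnorm y) ->
  has_partial f i z a -> has_partial g i z b ->
  has_partial (fun w => B (f w) (g w)) i z (B a (g z) + B (f z) b).
Proof.
move=> BDl BDr BZl BZr Bnorm fa gb.
have BNl x y : B (- x) y = - B x y.
  have := BZl (-1) x y.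
  by rewrite (_ : (-1)%:C = -1 :> R[i]) ?rmorphN1// !scaleN1r.
have BNr x y : B x (- y) = - B x y.
  have := BZr (-1) x y.
  by rewrite (_ : (-1)%:C = -1 :> R[i]) ?rmorphN1// !scaleN1r.
have gline := has_partial_line gb.
move: fa gb => /cvg_rnorm fa /cvg_rnorm gb; apply/cvg_rnorm.
pose G t := g (z + t *: direction i).
have bnd : (fun t : R => rnorm (diffquot f i z t - a) * (rnorm (G t - g z) + rnorm (g z))
     + rnorm a * rnorm (G t - g z) + rnorm (f z) * rnorm (diffquot g i z t - b))
     @ 0^' --> (0 : R).
  rewrite -[X in _ --> X](_ : 0 * (0 + rnorm (g z)) + rnorm a * 0 + rnorm (f z) * 0 = 0).
    by apply: cvgD; [apply: cvgD|]; apply: cvgM => //; try exact: cvg_cst;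
       apply: cvgD => //; exact: cvg_cst.
  by rewrite mul0r !mulr0 !addr0.
apply: squeeze_cvgr (cvg_cst (0 : R)) bnd.
near=> t; rewrite rnorm_ge0/=.
(* Each of the three terms has one factor tending to [0]: the error of the quotient of [f], the
   increment of [g] along the line, the error of the quotient of [g]. *)
have -> : diffquot (fun w => B (f w) (g w)) i z t - (B a (g z) + B (f z) b) =
    B (diffquot f i z t - a) (G t) + B a (G t - g z) + B (f z) (diffquot g i z t - b).
  rewrite {1 3}/diffquot -/(G t) !BDl !BDr !BZr !BZl !BDr !BDl !BNr !BNl.
  rewrite !scalerDr !scalerN.
  set X := B a (G t); set Y := _ *: B (f z) (G t).
  rewrite opprD; set P := _ *: B (f z) (g z); set Q := _ *: _; set U := B a _; set S := B (f z) b.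
  by rewrite !addrA subrK [Q - Y - U + Y]addrAC subrK [Q - U - P]addrAC.
apply: le_trans (rnormD _ _) _; apply: lerD; last exact: Bnorm.
apply: le_trans (rnormD _ _) _; apply: lerD; last exact: Bnorm.
apply: le_trans (Bnorm _ _) _; rewrite ler_wpM2l ?rnorm_ge0//.
by rewrite -{1}(subrK (g z) (G t)) rnormD.
Unshelve. all: by end_near. Qed.

End PartialDerivatives.

(** * The Moyal product at orders zero and one *)

Section LowOrderMoyal.
Context {R : realType} {d : nat} {V : hilbertType R}.
Local Notation opfun := (phase R d -> bop V).
Implicit Types (A B : @formal R d V).

(** For a multi-index of order one, all factors of the iterated derivative but one are the identity;
    [uniq s] prevents [D j] from acting twice. *)
Lemma foldr_iter_eq (T : Type) (I : eqType) (D : I -> T -> T) (n : I -> nat) j (s : seq I) f :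
  uniq s -> (forall k, n k = (k == j)) ->
  foldr (fun k g => iter (n k) (D k) g) f s = if j \in s then D j f else f.
Proof.
move=> + nE; elim: s => //= k s IH /andP[ks us].
rewrite IH// nE inE eq_sym; case: eqVneq => [jk|//] /=.
by rewrite -jk in ks *; rewrite (negbTE ks).
Qed.

Lemma partials0 (W : normedModType R[i]) (dir : 'I_d -> 'I_d + 'I_d) (n : 'I_d -> nat)
  (f : phase R d -> W) : (forall k, n k = 0%N) -> partials dir n f = f.
Proof. by move=> n0; rewrite /partials; elim: (enum _) => //= k s ->; rewrite n0. Qed.

Lemma partials_delta (W : normedModType R[i]) (dir : 'I_d -> 'I_d + 'I_d) (n : 'I_d -> nat) j
  (f : phase R d -> W) : (forall k, n k = (k == j)) -> partials dir n f = partial (dir j) f.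
Proof.
move=> nE; rewrite /partials (@foldr_iter_eq _ _ (fun k => partial (dir k)) _ j) ?enum_uniq//.
by rewrite mem_enum.
Qed.

Lemma morder_eq0 (n : 'I_d -> nat) : (morder n == 0)%N = [forall k, n k == 0%N].
Proof.
rewrite /morder sum_nat_eq0; apply: eq_forallb => k; exact: implyTb.
Qed.

(** The unit multi-index in direction [j]. The range ['I_k.+2] makes room for the value 1, so that
    [inord] does not truncate it. *)
Definition ffun_delta k (j : 'I_d) : {ffun 'I_d -> 'I_k.+2} :=
  [ffun i => inord (i == j)].

Lemma mindex_delta k j i : mindex (ffun_delta k j) i = (i == j).
Proof. by rewrite /mindex ffunE inordK//; case: (i == j). Qed.

Lemma morder_mindex_eq0 k (a : {ffun 'I_d -> 'I_k.+1}) :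
  (morder (mindex a) == 0)%N = (a == [ffun=> ord0]).
Proof.
rewrite morder_eq0; apply/forallP/eqP => [a0|-> i]; last by rewrite /mindex ffunE.
by apply/ffunP => i; rewrite ffunE; apply/val_inj/eqP; exact: a0.
Qed.

Lemma morder_mindex_eq1 k (a : {ffun 'I_d -> 'I_k.+2}) :
  (morder (mindex a) == 1)%N = (a \in [set ffun_delta k j | j : 'I_d]%SET).
Proof.
apply/idP/imsetP => [|[j _ ->]].
  move=> /sum_nat_eq1[j [_ aj a0]]; exists j => //.
  apply/ffunP => i; apply/val_inj; rewrite /= -/(mindex (ffun_delta k j) i) mindex_delta.
  by case: eqVneq => [->|ij]; [exact: aj|exact: a0].
rewrite /morder (eq_bigr (fun i => (i == j) : nat)); last by move=> i _; exact: mindex_delta.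
by rewrite (bigD1 j)//= eqxx big1 ?addn0// => i /negbTE ->.
Qed.

Lemma ffun_delta_inj k : injective (ffun_delta k).
Proof.
move=> i j ij; have := mindex_delta k j i.
by rewrite -ij mindex_delta eqxx; case: eqVneq.
Qed.

Lemma sum_mindex1 k (W : nmodType) (X : {ffun 'I_d -> 'I_k.+2} -> W) :
  \sum_(a | (morder (mindex a) == 1)%N) X a = \sum_(j < d) X (ffun_delta k j).
Proof.
rewrite (eq_bigl _ _ (@morder_mindex_eq1 k)) big_imset//=.
by move=> i j _ _; exact: ffun_delta_inj.
Qed.

Local Notation ffun0 := [ffun=> ord0].

Lemma morder_mindex0 k : morder (mindex (ffun0 : {ffun 'I_d -> 'I_k.+1})) = 0%N.
Proof. by apply/eqP; rewrite morder_mindex_eq0. Qed.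

Lemma sum_order0 k (W : nmodType) (X : {ffun 'I_d -> 'I_k.+1} -> {ffun 'I_d -> 'I_k.+1} -> W) :
  \sum_a \sum_b (if (morder (mindex a) + morder (mindex b) == 0)%N then X a b else 0)
  = X ffun0 ffun0.
Proof.
rewrite pair_big -big_mkcond/= (big_pred1 (ffun0, ffun0))//= => -[a b] /=.
by rewrite addn_eq0 !morder_mindex_eq0 xpair_eqE.
Qed.

(** Total order one forces one multi-index to be zero and the other to be a unit one. The row
    [a = 0] gives the first sum; in every other row only the entry [b = 0] can survive. *)
Lemma sum_order1 k (W : nmodType) (X : {ffun 'I_d -> 'I_k.+2} -> {ffun 'I_d -> 'I_k.+2} -> W) :
  \sum_a \sum_b (if (morder (mindex a) + morder (mindex b) == 1)%N then X a b else 0)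
  = \sum_(j < d) X ffun0 (ffun_delta k j) + \sum_(j < d) X (ffun_delta k j) ffun0.
Proof.
rewrite (bigD1 ffun0)//=; congr (_ + _).
  rewrite -(sum_mindex1 (X ffun0)) [RHS]big_mkcond; apply: eq_bigr => b _.
  by rewrite morder_mindex0 add0n.
rewrite -(sum_mindex1 (X ^~ ffun0)) [RHS]big_mkcond [RHS](bigD1 ffun0)//= morder_mindex0/= add0r.
apply: eq_bigr => a; rewrite -morder_mindex_eq0 => a0.
rewrite (bigD1 ffun0)//= morder_mindex0 addn0 big1 ?addr0// => b.
rewrite -morder_mindex_eq0 addn_eq1 (negbTE a0).
by case: (morder (mindex b)) => [//|n _]; rewrite andbF.
Qed.

Lemma mfact1 (n : 'I_d -> nat) : (forall i, (n i <= 1)%N) -> mfact n = 1%N.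
Proof. by move=> n1; rewrite /mfact big1// => i _; case: (n i) (n1 i) => [|[]]. Qed.

Lemma morder_delta (n : 'I_d -> nat) j : (forall i, n i = (i == j)) -> morder n = 1%N.
Proof.
move=> nE; rewrite /morder (bigD1 j)//= nE eqxx big1 ?addn0// => i /negbTE ij.
by rewrite nE ij.
Qed.

Lemma moyal_term00 (a b : 'I_d -> nat) (A B : opfun) z :
  (forall i, a i = 0%N) -> (forall i, b i = 0%N) ->
  moyal_term a b A B z = bop_comp (A z) (B z).
Proof.
move=> a0 b0; rewrite /moyal_term /Dqp !partials0//.
have -> : morder a = 0%N by rewrite /morder big1.
have -> : morder b = 0%N by rewrite /morder big1.
rewrite !mfact1; try by move=> i; rewrite ?a0 ?b0.
by rewrite expr0 !mulr1 invr1 mulr1 scale1r.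
Qed.

Lemma moyal_term01 (a b : 'I_d -> nat) j (A B : opfun) z :
  (forall i, a i = 0%N) -> (forall i, b i = (i == j)) ->
  moyal_term a b A B z =
  (2 * 'i)^-1 *: bop_comp (partial (inr j) A z) (partial (inl j) B z).
Proof.
move=> a0 bE; rewrite /moyal_term /Dqp !(partials0 _ _ a0) !(partials_delta _ _ bE).
have -> : morder a = 0%N by rewrite /morder big1.
rewrite (morder_delta bE) !mfact1.
- by rewrite expr0 expr1 !mulr1 mul1r.
- by move=> i; rewrite bE; case: (i == j).
- by move=> i; rewrite a0.
Qed.

Lemma moyal_term10 (a b : 'I_d -> nat) j (A B : opfun) z :
  (forall i, a i = (i == j)) -> (forall i, b i = 0%N) ->
  moyal_term a b A B z =
  - ((2 * 'i)^-1 *: bop_comp (partial (inl j) A z) (partial (inr j) B z)).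
Proof.
move=> aE b0; rewrite /moyal_term /Dqp !(partials0 _ _ b0) !(partials_delta _ _ aE).
have -> : morder b = 0%N by rewrite /morder big1.
rewrite (morder_delta aE) !mfact1.
- by rewrite !expr1 !mulr1 mulN1r scaleNr.
- by move=> i; rewrite b0.
- by move=> i; rewrite aE; case: (i == j).
Qed.

Lemma mindex0 k i : mindex (ffun0 : {ffun 'I_d -> 'I_k.+1}) i = 0%N.
Proof. by rewrite /mindex ffunE. Qed.

Lemma moyal0 A B z : moyal A B 0%N z = bop_comp (A 0%N z) (B 0%N z).
Proof.
rewrite -(moyal_term00 _ _ z (mindex0 0) (mindex0 0)).
rewrite -(sum_order0 (fun a b => moyal_term (mindex a) (mindex b) (A 0%N) (B 0%N) z)).
apply: eq_bigr => a _; apply: eq_bigr => b _.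
by rewrite big_ord1 big_mkcond big_ord1 /= !addn0.
Qed.

Lemma moyal1 A B z : moyal A B 1%N z =
  bop_comp (A 0%N z) (B 1%N z) + bop_comp (A 1%N z) (B 0%N z)
  + (2 * 'i)^-1 *: \sum_(j < d)
      (bop_comp (partial (inr j) (A 0%N) z) (partial (inl j) (B 0%N) z)
       - bop_comp (partial (inl j) (A 0%N) z) (partial (inr j) (B 0%N) z)).
Proof.
pose X j l a b := moyal_term (@mindex d 1 a) (@mindex d 1 b) (A j) (B l) z.
rewrite -(moyal_term00 (A 0%N) (B 1%N) z (mindex0 1) (mindex0 1)).
rewrite -(moyal_term00 (A 1%N) (B 0%N) z (mindex0 1) (mindex0 1)).
rewrite -/(X _ _ _ _) -/(X _ _ _ _) -(sum_order0 (X 0%N 1%N)) -(sum_order0 (X 1%N 0%N)).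
(* For fixed [a] and [b], the pairs [(j, l) = (0, 1)] and [(1, 0)] leave order zero for the
   derivatives and [(0, 0)] leaves order one, while [(1, 1)] already exceeds the total. *)
transitivity (
    \sum_a \sum_b (if (morder (mindex a) + morder (mindex b) == 0)%N then X 0%N 1%N a b else 0)
  + \sum_a \sum_b (if (morder (mindex a) + morder (mindex b) == 0)%N then X 1%N 0%N a b else 0)
  + \sum_a \sum_b (if (morder (mindex a) + morder (mindex b) == 1)%N then X 0%N 0%N a b else 0)).
  rewrite -!big_split; apply: eq_bigr => a _; rewrite -!big_split; apply: eq_bigr => b _ /=.
  rewrite !big_ord_recl big_ord0 [X in X + _]big_mkcond !big_ord_recl !big_ord0 /= !addn0 !addr0.
  rewrite /bump /= !addn0 !addn1 !eqSS addrC addrAC -!addrA.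
  congr (_ + (_ + _)); rewrite big_mkcond !big_ord_recl big_ord0 /= /bump /=.
  by rewrite !addn0 !addn1 !eqSS !addr0.
congr (_ + _); rewrite sum_order1 scaler_sumr -big_split; apply: eq_bigr => j _ /=.
rewrite /X (moyal_term01 _ _ _ (mindex0 1) (mindex_delta 0 j)).
by rewrite (moyal_term10 _ _ _ (mindex_delta 0 j) (mindex0 1)) scalerBr.
Qed.

(** The derivatives of the right factor are prescribed only on the vector [x]. For [B = fadj u] and
    [x = chi b] they are then derivatives of [psi b]. *)
Lemma moyal1_apply A B z x DA DBx :
  (forall i, partial i (A 0%N) z = DA i) -> (forall i, partial i (B 0%N) z x = DBx i) ->
  moyal A B 1%N z x = A 0%N z (B 1%N z x) + A 1%N z (B 0%N z x)
  + (2 * 'i)^-1 *: \sum_(j < d)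
      (DA (inr j) (DBx (inl j)) - DA (inl j) (DBx (inr j))).
Proof.
move=> DAE DBE; rewrite moyal1 !bopDl bopZl bop_suml; congr (_ + _ *: _).
by apply: eq_bigr => j _; rewrite -!DAE -!DBE.
Qed.

End LowOrderMoyal.

(** * Adjoints that are inverses, and differentiation of an inverse *)

Section InverseOperators.
Context {R : realType} {d : nat} {V : hilbertType R}.

(** [xget] returns its default [0] when no adjoint exists, so a nonzero value certifies
    existence. *)
Lemma adjP (T : bop V) : adj T != 0 -> forall x y, ⟨adj T x, y⟩ = ⟨x, T y⟩.
Proof.
have [ex _|nex] := pselect (exists S : bop V, forall x y, ⟨S x, y⟩ = ⟨x, T y⟩).
  exact: (xgetPex 0 ex).
rewrite /adj xgetPN ?eqxx// => S ST; apply: nex; by exists S.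
Qed.

(* If no adjoint exists then adj T = 0, and adj T T = 1 forces V = 0. *)
Lemma unitary_adj (T : bop V) : bop_comp (adj T) T = bop_id ->
  forall x y, ⟨adj T x, y⟩ = ⟨x, T y⟩.
Proof.
move=> TT; have [T0|] := eqVneq (adj T) 0; last exact: adjP.
have V0 (x : V) : x = 0 by rewrite -[x]/(bop_id x) -TT T0.
by move=> x y; rewrite (V0 y) bop0r !dotH0r.
Qed.

(** [adj T] is isometric, since [⟨adj T x, adj T x⟩ = ⟨x, T (adj T x)⟩ = ⟨x, x⟩]. This supplies the
    uniform bound required by [has_partial_inv]. *)
Lemma unitary_opnorm_adj (T : bop V) :
  bop_comp (adj T) T = bop_id -> bop_comp T (adj T) = bop_id -> opnorm (adj T) <= 1.
Proof.
move=> wT Tw; apply: opnorm_le => x x1; apply: le_trans x1.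
have : ⟨adj T x, adj T x⟩ = ⟨x, x⟩.
  by rewrite unitary_adj// -bop_compE Tw.
rewrite !dotHxx => /(congr1 (@complex.Re R))/= /eqP.
by rewrite eqrXn2 ?rnorm_ge0// => /eqP ->.
Qed.

(** The resolvent-type identity [w(y) - w(z) = - w(y) (u(y) - u(z)) w(z)] is used twice: with the
    bound [M] it gives continuity of [w] along the line, and divided by [t] it gives the derivative
    [- w a w]. *)
Lemma has_partial_inv (u w : phase R d -> bop V) (M : R) i z a :
  (forall z, bop_comp (w z) (u z) = bop_id) ->
  (forall z, bop_comp (u z) (w z) = bop_id) ->
  (forall z, opnorm (w z) <= M) ->
  has_partial u i z a ->
  has_partial w i z (- bop_comp (w z) (bop_comp a (w z))).
Proof.
move=> wu uw wM ua; have uline := has_partial_line ua.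
move: ua => /cvg_rnorm ua; apply/cvg_rnorm.
pose y t := z + t *: direction i.
have M0 : 0 <= M by exact: le_trans (opnorm_ge0 _) (wM z).
have wuK t x : w t (u t x) = x by rewrite -bop_compE wu.
have uwK t x : u t (w t x) = x by rewrite -bop_compE uw.
have comp3 t (S : bop V) t' : rnorm (bop_comp (w t) (bop_comp S (w t'))) <= M * (rnorm S * M).
  rewrite !rnorm_bopE; apply: le_trans (opnorm_comp_le _ _) _.
  rewrite ler_pM ?opnorm_ge0//; apply: le_trans (opnorm_comp_le _ _) _.
  by rewrite ler_wpM2l ?opnorm_ge0.
have wB t : w (y t) - w z = - bop_comp (w (y t)) (bop_comp (u (y t) - u z) (w z)).
  apply: bop_ext => x; rewrite bopBl bopNl !bop_compE bopBl bopBr.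
  by rewrite wuK uwK opprB.
have bnd : (fun t : R => M * (rnorm (diffquot u i z t - a) * M)
    + M * (rnorm (u (y t) - u z) * M) * (rnorm a * M)) @ 0^' --> (0 : R).
  rewrite -[X in _ --> X](_ : M * (0 * M) + M * (0 * M) * (rnorm a * M) = 0); last first.
    by rewrite !(mul0r, mulr0) addr0.
  apply: cvgD; first by apply: cvgM; [exact: cvg_cst|apply: cvgM => //; exact: cvg_cst].
  apply: cvgM; last exact: cvg_cst.
  by apply: cvgM; [exact: cvg_cst|apply: cvgM => //; exact: cvg_cst].
apply: squeeze_cvgr (cvg_cst (0 : R)) bnd.
near=> t; rewrite rnorm_ge0/=.
have -> : diffquot w i z t - - bop_comp (w z) (bop_comp a (w z)) =
    - bop_comp (w (y t)) (bop_comp (diffquot u i z t - a) (w z))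
    - bop_comp (w (y t) - w z) (bop_comp a (w z)).
  have -> : diffquot w i z t = - bop_comp (w (y t)) (bop_comp (diffquot u i z t) (w z)).
    rewrite {1}/diffquot -/(y t) wB scalerN; congr (- _); apply: bop_ext => x.
    by rewrite bopZl !bop_compE bopZl bopZr.
  apply: bop_ext => x; rewrite !(bopBl, bopNl, bop_compE) !(bopBr, bopNr).
  by rewrite !opprB opprK [RHS]addrC addrA subrK addrC.
apply: le_trans (rnormD _ _) _; apply: lerD.
  by rewrite /rnorm normrN -/(rnorm _); exact: comp3.
rewrite /rnorm normrN -/(rnorm _) !rnorm_bopE; apply: le_trans (opnorm_comp_le _ _) _.
rewrite ler_pM ?opnorm_ge0//.
  by rewrite wB -rnorm_bopE /rnorm normrN -/(rnorm _); exact: comp3.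
by apply: le_trans (opnorm_comp_le _ _) _; rewrite ler_wpM2l ?opnorm_ge0.
Unshelve. all: by end_near. Qed.

End InverseOperators.

(** * Product rules, Poisson brackets and the differentiated eigenvalue equation *)

Section PartialsOfProducts.
Context {R : realType} {d : nat} {V : hilbertType R}.
Implicit Types (S T : phase R d -> bop V) (f g : phase R d -> V).

Lemma has_partial_comp S T i z a b :
  has_partial S i z a -> has_partial T i z b ->
  has_partial (fun y => bop_comp (S y) (T y)) i z (bop_comp a (T z) + bop_comp (S z) b).
Proof.
apply: (has_partial_bilinear (B := bop_comp)).
- by move=> A A' B; apply: bop_ext.
- by move=> A B B'; apply: bop_ext => x; rewrite bopDl !bop_compE bopDl bopDr.
- by move=> c A B; apply: bop_ext.
- by move=> c A B; apply: bop_ext => x; rewrite bopZl !bop_compE bopZl bopZr.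
- exact: opnorm_comp_le.
Qed.

Lemma has_partial_apply S f i z a b :
  has_partial S i z a -> has_partial f i z b ->
  has_partial (fun y => S y (f y)) i z (a (f z) + S z b).
Proof.
apply: (has_partial_bilinear (B := fun (S : bop V) x => S x)).
- by [].
- by move=> A x y; exact: bopDr.
- by [].
- by move=> c A x; exact: bopZr.
- by move=> A x; exact: opnormP.
Qed.

(* The inner product is carried to multiples of the identity, so that scalar and
   operator-valued functions share one notion of partial derivative. *)
Lemma has_partial_dot f g i z a b :
  has_partial f i z a -> has_partial g i z b ->
  has_partial (fun y => ⟨f y, g y⟩ *: (bop_id : bop V)) i z
    (⟨a, g z⟩ *: bop_id + ⟨f z, b⟩ *: bop_id).
Proof.
apply: (has_partial_bilinear (B := fun x y => ⟨x, y⟩ *: (bop_id : bop V))).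
- by move=> x x' y; rewrite dotHDl scalerDl.
- by move=> x y y'; rewrite dotHDr scalerDl.
- by move=> c x y; rewrite dotHZl [Num.conj _](conjc_real c) scalerA.
- by move=> c x y; rewrite dotHZr scalerA.
- move=> x y; rewrite rnormZ rnorm_bopE.
  apply: le_trans (cauchy_schwarz x y).
  by rewrite ler_piMr ?modC_ge0// opnorm_id_le1.
Qed.

(** The eigenvalue inherits differentiability from [T] and [psi] through [E = ⟨psi, T psi⟩]. What is
    kept of the derivative is that it is a multiple of the identity. *)
Lemma has_partial_eigenvalue (T : phase R d -> bop V) (E : phase R d -> R) psi i z a b :
  (forall y, T y (psi y) = (E y)%:C *: psi y) -> (forall y, ⟨psi y, psi y⟩ = 1) ->
  has_partial T i z a -> has_partial psi i z b ->
  exists c, has_partial (scalar_op E) i z (c *: bop_id : bop V).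
Proof.
move=> Tpsi psi1 Ta psib.
have -> : scalar_op E = (fun y => ⟨psi y, T y (psi y)⟩ *: (bop_id : bop V)).
  by apply/funext => y; rewrite Tpsi dotHZr psi1 mulr1.
exists (⟨b, T z (psi z)⟩ + ⟨psi z, a (psi z) + T z b⟩).
by rewrite scalerDl; apply: has_partial_dot => //; exact: has_partial_apply.
Qed.

Lemma poissonD S T f z SD TD :
  (forall i, has_partial S i z (SD i)) -> (forall i, has_partial T i z (TD i)) ->
  poisson (fun y => S y + T y) f z = poisson S f z + poisson T f z.
Proof.
move=> SP TP; rewrite /poisson -big_split; apply: eq_bigr => j _ /=.
rewrite !(partialE (has_partialD (SP _) (TP _))) !(partialE (SP _)) !(partialE (TP _)).
by rewrite !bopDl opprD addrACA.
Qed.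

Lemma poissonB S T f z SD TD :
  (forall i, has_partial S i z (SD i)) -> (forall i, has_partial T i z (TD i)) ->
  poisson (fun y => S y - T y) f z = poisson S f z - poisson T f z.
Proof.
move=> SP TP.
rewrite (poissonD f SP (fun i => has_partialN (TP i))); congr (_ + _).
rewrite /poisson -sumrN; apply: eq_bigr => j _.
by rewrite !(partialE (has_partialN (TP _))) !(partialE (TP _)) !bopNl opprB opprK addrC.
Qed.

(* Differentiating H psi = E psi and u psi = chi eliminates the derivatives of u. *)
Lemma eigenvector_transport (u H : phase R d -> bop V) (E : phase R d -> R) psi chi i k z
    ui Hi Hk uHi ek psii psik :
  (forall y, H y (psi y) = (E y)%:C *: psi y) -> (forall y, u y (psi y) = chi) ->
  has_partial u i z ui -> has_partial H i z Hi -> has_partial H k z Hk ->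
  has_partial (fun y => bop_comp (u y) (H y)) i z uHi ->
  has_partial (scalar_op E) k z (ek *: bop_id : bop V) ->
  has_partial psi i z psii -> has_partial psi k z psik ->
  ui (Hk (psi z)) + uHi psik
    - (E z)%:C *: ui psik
  = u z (Hi psik) - u z (ek *: psii).
Proof.
move=> Hpsi upsi ui_ Hi_ Hk_ /partialE <- ek_ psii_ psik_.
rewrite (partialE (has_partial_comp ui_ Hi_)).
have Hk_psi : Hk (psi z) = ek *: psi z + (E z)%:C *: psik - H z psik.
  have := partialE (has_partial_apply Hk_ psik_).
  rewrite (_ : (fun y => _) = fun y => (scalar_op E y : bop V) (psi y)); last first.
    by apply/funext => y; rewrite Hpsi.
  rewrite (partialE (has_partial_apply ek_ psik_)) => /(congr1 (fun x => x - H z psik)).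
  by rewrite addrK => <-.
have ui_psi : ui (psi z) = - u z psii.
  have := partialE (has_partial_apply ui_ psii_).
  rewrite (_ : (fun y => _) = fun=> chi); last by apply/funext => y; rewrite upsi.
  by rewrite (partialE (has_partial_cst _ _ _)) => /esym/eqP; rewrite addr_eq0 => /eqP.
rewrite Hk_psi bopDl !bop_compE bopBr bopDr !bopZr ui_psi scalerN.
by rewrite addrA subrK addrAC addrK addrC.
Qed.

End PartialsOfProducts.

(** * The action of the frame map on basis vectors *)

Section FrameTransport.
Context {R : realType} {V : hilbertType R}.

Lemma projection_range (P : bop V) x : orthogonal_projection P -> range P x -> P x = x.
Proof. by move=> [PP _] [y _ <-]; rewrite -bop_compE PP. Qed.

Lemma double_orthocomp (M : set V) x : M x -> orthocomp (orthocomp M) x.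
Proof. by move=> Mx y /(_ _ Mx) xy; rewrite dotHC xy conjc0. Qed.

(** At [e b] the defining sequence is eventually constant: orthonormality leaves the single term
    [f b], and [r] vanishes because [e b] lies in the double orthocomplement of [M]. *)
Lemma frame_map (l : option nat) (M N : set V) (e f : nat -> V) (r : bop V) (u : bop V) b :
  orthonormal_basis l M e -> unitary_onto_ext0 (orthocomp M) N r ->
  (forall x, (fun n => \sum_(a < n | below l a) ⟨e a, x⟩ *: f a + r x) @ \oo --> u x) ->
  below l b -> u (e b) = f b.
Proof.
move=> [Me e_on _] [_ _ r0] /(_ (e b)) ucvg lb.
apply: cvg_unique ucvg _; first exact: norm_hausdorff.
(* The sum over [a < n] contains the index [b] exactly when [n] is at least [b.+1]. *)
apply: cvg_near_cst; exists b.+1 => // n /= bn.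
rewrite (r0 _ (double_orthocomp (Me _ lb))) addr0 (bigD1 (Ordinal bn))//= e_on// eqxx scale1r.
rewrite big1 ?addr0// => a /andP[la ab].
rewrite e_on//; case: eqVneq => [ab'|_]; last by rewrite scale0r.
by case/eqP: ab; exact: val_inj.
Qed.

End FrameTransport.

(** * Matrix elements of the first two coefficients of [h] *)

Theorem mainTheorem6 (R : realType) (d : nat) (Hf : hilbertType R)
  (m rho eps0 : R) (H : R -> phase R d -> bop Hf) (Hj : nat -> phase R d -> bop Hf)
  (sigmar : phase R d -> set R[i]) (Er : phase R d -> R) (l : option nat)
  (pi0 : phase R d -> bop Hf) (pis : nat -> phase R d -> bop Hf)
  (psi : nat -> phase R d -> Hf) (pir : bop Hf) (chi : nat -> Hf)
  (r : phase R d -> bop Hf) (u0 : phase R d -> bop Hf)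
  (u : nat -> phase R d -> bop Hf) :
  separable_space Hf ->
  0 <= rho <= 1 ->
  condIG m rho eps0 H Hj sigmar \/ condCG m rho eps0 H Hj sigmar ->
  (forall z, sigmar z = [set (Er z)%:C]) ->
  (forall z, is_eigenvalue_of_mult (Hj 0%N z) (Er z)%:C l) ->
  (forall z, spectral_projector (Hj 0%N z) (Er z)%:C (pi0 z)) ->
  pis 0%N = pi0 ->
  (forall j, symbol (- (j%:R * rho)) rho (pis j)) ->
  moyal pis pis = pis ->
  fadj pis = pis ->
  moyal Hj pis = moyal pis Hj ->
  (forall z, orthonormal_basis l (range (pi0 z)) (fun a => psi a z)) ->
  (forall a, below l a -> smooth (psi a)) ->
  orthogonal_projection pir ->
  orthonormal_basis l (range pir) chi ->
  (forall z, unitary_onto_ext0 (orthocomp (range (pi0 z)))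
                               (orthocomp (range pir)) (r z)) ->
  (forall z x, (fun n => \sum_(a < n | below l a) ⟨psi a z, x⟩ *: chi a + r z x)
                 @ \oo --> u0 z x) ->
  symbol 0 rho u0 ->
  u 0%N = u0 ->
  (forall j, symbol (- (j%:R * rho)) rho (u j)) ->
  moyal (fadj u) u = fconst bop_id ->
  moyal u (fadj u) = fconst bop_id ->
  moyal (moyal u pis) (fadj u) = fconst pir ->
  let h := moyal (moyal u Hj) (fadj u) in
  let hfirst (eps : R) z := h 0%N z + eps%:C *: h 1%N z in
  forall (eps : R) (z : phase R d) (a b : nat), below l a -> below l b ->
  let h1ab := ⟨chi a, h 1%N z (chi b)⟩ in
  [/\ ⟨chi a, hfirst eps z (chi b)⟩ = (Er z)%:C * (a == b)%:R + eps%:C * h1ab,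
      h1ab = ⟨psi a z, Hj 1%N z (psi b z)⟩
             - 'i / 2 * ⟨psi a z, poisson (fun w => Hj 0%N w + scalar_op Er w) (psi b) z⟩
    & h1ab = ⟨psi a z, Hj 1%N z (psi b z)⟩
             - 'i * ⟨psi a z, poisson (scalar_op Er) (psi b) z⟩
             - 'i / 2 * ⟨psi a z, poisson (fun w => Hj 0%N w - scalar_op Er w) (psi b) z⟩].
Proof.
move=> _ _ cond _ _ spec pis0 _ _ _ Hpi psi_on psi_smooth _ chi_on r_on u0cvg [u0_smooth _] u00 _ wu uw _.
move=> h hfirst eps z a b la lb h1ab.
have H0_smooth : smooth (Hj 0%N).
  by case: cond => -[[_ _ /(_ 0%N)[]]].
pose w y := adj (u0 y).
have wu0 y : bop_comp (w y) (u0 y) = bop_id.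
  by have := congr1 (fun f => f 0%N y) wu; rewrite moyal0 /fadj /fconst eqxx u00.
have uw0 y : bop_comp (u0 y) (w y) = bop_id.
  by have := congr1 (fun f => f 0%N y) uw; rewrite moyal0 /fadj /fconst eqxx u00.
have upsi c y : below l c -> u0 y (psi c y) = chi c.
  by move=> lc; apply: (frame_map (psi_on y) (r_on y) (u0cvg y) lc).
have wchi c y : below l c -> w y (chi c) = psi c y.
  by move=> lc; rewrite -(upsi _ y lc) -bop_compE wu0.
have chi_u0 y x : ⟨chi a, u0 y x⟩ = ⟨psi a y, x⟩.
  by rewrite -(wchi a y la) (unitary_adj (wu0 y)).
have [pi0P pi0R] := all_and2 spec.
have psi_range c y : below l c -> range (pi0 y) (psi c y).
  by move=> lc; have [+ _ _] := psi_on y; apply.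
have Hpsi c y : below l c -> Hj 0%N y (psi c y) = (Er y)%:C *: psi c y.
  by move=> lc; have := psi_range c y lc; rewrite pi0R.
(* Insert [pi0] in front of [psi a], move it across by self-adjointness and commute it with [H_0]:
   then [H_0] acts on a vector of the eigenspace. *)
have psi_H0 y x : ⟨psi a y, Hj 0%N y x⟩ = (Er y)%:C * ⟨psi a y, x⟩.
  have pipsi := projection_range (pi0P y) (psi_range a y la).
  have [_ sa] := pi0P y.
  have Hpiy : Hj 0%N y (pi0 y x) = pi0 y (Hj 0%N y x).
    have := congr1 (fun f => f 0%N y) Hpi; rewrite !moyal0 pis0.
    by move=> /(congr1 (fun T : bop Hf => T x)).
  rewrite -{1}pipsi sa -Hpiy.
  have : range (pi0 y) (pi0 y x) by exists x.
  by rewrite pi0R => ->; rewrite dotHZr -sa pipsi.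
have psi1 y : ⟨psi b y, psi b y⟩ = 1.
  by have [_ + _] := psi_on y => /(_ b b lb lb); rewrite eqxx.
(* The derivatives at [z] are packed with their certificates, so that the algebra below sees opaque
   operators instead of limits. *)
have [uD uDP] : {uD | forall i, has_partial u0 i z (uD i)}.
  by exists (fun i => partial i u0 z) => i; exact: smooth_partial.
have [HD HDP] : {HD | forall i, has_partial (Hj 0%N) i z (HD i)}.
  by exists (fun i => partial i (Hj 0%N) z) => i; exact: smooth_partial.
have [psiD psiDP] : {psiD | forall i, has_partial (psi b) i z (psiD i)}.
  by exists (fun i => partial i (psi b) z) => i; apply: smooth_partial; exact: psi_smooth.
have [uHD uHDP] : {uHD | forall i, has_partial (fun y => bop_comp (u0 y) (Hj 0%N y)) i z (uHD i)}.
  by eexists => i; exact: has_partial_comp (uDP i) (HDP i).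
have [wD wDP] : {wD | forall i, has_partial w i z (wD i)}.
  eexists => i.
  exact: has_partial_inv wu0 uw0 (fun y => unitary_opnorm_adj (wu0 y) (uw0 y)) (uDP i).
have ED i : exists c, has_partial (scalar_op Er) i z (c *: bop_id : bop Hf).
  exact: (has_partial_eigenvalue (fun y => Hpsi b y lb) psi1 (HDP i) (psiDP i)).
have [ec ecP] := choice ED.
(* As [chi b] does not depend on the phase point, this differentiates [w y (chi b) = psi b y]. *)
have wDchi i : wD i (chi b) = psiD i.
  have := partialE (has_partial_apply (wDP i) (has_partial_cst (chi b) i z)).
  rewrite bop0r addr0 => <-; rewrite -(partialE (psiDP i)); congr (partial i _ z).
  by apply/funext => y; rewrite wchi.
have u0_adj : fadj u 0%N = w by rewrite /w -u00.
have uH0 : moyal u Hj 0%N = fun y => bop_comp (u0 y) (Hj 0%N y).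
  by apply/funext => y; rewrite moyal0 u00.
have partial_u i : partial i (u 0%N) z = uD i by rewrite u00; exact: partialE.
have partial_w i : partial i (fadj u 0%N) z (chi b) = psiD i.
  by rewrite u0_adj (partialE (wDP i)).
have partial_H i : partial i (Hj 0%N) z (psi b z) = HD i (psi b z).
  by rewrite (partialE (HDP i)).
have partial_uH i : partial i (moyal u Hj 0%N) z = uHD i.
  by rewrite uH0; exact: partialE.
pose kap : R[i] := (2 * 'i)^-1.
have kapE : kap = - ('i / 2).
  by rewrite /kap invfM invCi mulrN mulrC.
pose Y := fadj u 1%N z (chi b).
(* Order one of [u # u^* = 1], applied to [chi b] and solved for the term containing [u_1^*]. *)
have uY : u0 z Y = - (u 1%N z (psi b z)) - kap *: \sum_(j < d)
    (uD (inr j) (psiD (inl j)) - uD (inl j) (psiD (inr j))).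
  have := moyal1_apply partial_u partial_w.
  rewrite uw u0_adj u00 wchi// -/Y [LHS]bop0l -addrA => /esym/eqP.
  by rewrite addr_eq0 opprD => /eqP.
have h0chi : h 0%N z (chi b) = (Er z)%:C *: chi b.
  by rewrite /h moyal0 uH0 !bop_compE u0_adj wchi// Hpsi// bopZr upsi.
have chi_ab : ⟨chi a, chi b⟩ = (a == b)%:R.
  by have [_ + _] := chi_on; apply.
have poisson_E : poisson (scalar_op Er) (psi b) z
    = \sum_(j < d) (ec (inr j) *: psiD (inl j) - ec (inl j) *: psiD (inr j)).
  apply: eq_bigr => j _.
  by rewrite !(partialE (psiDP _)) !(partialE (ecP _)).
have poisson_H : poisson (Hj 0%N) (psi b) z
    = \sum_(j < d) (HD (inr j) (psiD (inl j)) - HD (inl j) (psiD (inr j))).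
  apply: eq_bigr => j _.
  by rewrite !(partialE (psiDP _)) !(partialE (HDP _)).
have bracket i k : ⟨chi a, uD i (HD k (psi b z))⟩ + ⟨chi a, uHD i (psiD k)⟩
    - (Er z)%:C * ⟨chi a, uD i (psiD k)⟩ = ⟨psi a z, HD i (psiD k)⟩ - ec k * ⟨psi a z, psiD i⟩.
  rewrite -dotHZr -dotHDr -dotHBr.
  rewrite (eigenvector_transport (fun y => Hpsi b y lb) (fun y => upsi b y lb)
    (uDP i) (HDP i) (HDP k) (uHDP i) (ecP k) (psiDP i) (psiDP k)).
  by rewrite dotHBr !chi_u0 dotHZr.
have h1E : h1ab = ⟨psi a z, Hj 1%N z (psi b z)⟩
    + kap * ⟨psi a z, poisson (Hj 0%N) (psi b) z + poisson (scalar_op Er) (psi b) z⟩.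
  rewrite /h1ab /h (moyal1_apply partial_uH partial_w) -/Y u0_adj wchi//.
  rewrite (moyal1_apply partial_u partial_H) uH0 u00 bop_compE Hpsi// bopZr.
  rewrite poisson_E poisson_H.
  rewrite !dotHDr !dotHZr !dotH_sumr !chi_u0 psi_H0 -(chi_u0 z Y) uY.
  rewrite dotHBr dotHNr dotHZr dotH_sumr.
  set S1 := \sum_(j < d) _; set S2 := \sum_(j < d) _; set S3 := \sum_(j < d) _.
  set S4 := \sum_(j < d) _; set S5 := \sum_(j < d) _.
  (* The [u_1] terms cancel, since both carry the factor [Er z]. What remains is [bracket] at
     [(p_j, q_j)] minus [bracket] at [(q_j, p_j)]; exchanging the two directions turns the terms
     [- ec k ⟨psi a, psiD i⟩] into the bracket of [Er] with a plus sign. *)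
  have -> : S4 + S5 = S2 + S3 - (Er z)%:C * S1.
    rewrite mulr_sumr -sumrN -!big_split; apply: eq_bigr => j _ /=.
    rewrite !dotHBr !dotHZr.
    transitivity (
      (⟨psi a z, HD (inr j) (psiD (inl j))⟩ - ec (inl j) * ⟨psi a z, psiD (inr j)⟩)
      - (⟨psi a z, HD (inl j) (psiD (inr j))⟩ - ec (inr j) * ⟨psi a z, psiD (inl j)⟩)).
      by ring.
    by rewrite -!bracket; ring.
  rewrite -/kap; ring.
split.
- by rewrite /hfirst bopDl bopZl dotHDr dotHZr h0chi dotHZr chi_ab.
- by rewrite h1E (poissonD _ HDP ecP) kapE mulNr.
- rewrite h1E (poissonB _ HDP ecP) kapE dotHDr dotHBr.
  (* With [k = i/2], and [P], [Q] the brackets of [H_0] and [Er] paired with [psi a], the second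
     form is [- k (P + Q) = - 2 k Q - k (P - Q)]. *)
  set k := 'i / 2; have <- : k + k = 'i%R by rewrite -splitr.
  move: k ⟨_, poisson (Hj 0%N) _ _⟩ ⟨_, poisson (scalar_op Er) _ _⟩ => k P Q.
  by ring.
Qed.
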